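(* Let $L/F_0$ be a cyclic Galois field extension of degree $n$ with $\mathrm{Gal}(L/F_0)=\langle\sigma\rangle$ and $F/F_0$ a cyclic Galois field extension of degree $m$ with $\mathrm{Gal}(F/F_0)=\langle\tau\rangle$, with $L$ and $F$ linearly disjoint over $F_0$, and let $K=L\otimes_{F_0}F$ be their composite. Let $(F/F_0,\tau,d)$ be a nonassociative cyclic algebra of degree $m$ (so $d\in F\setminus F_0$). Let $D_0=(L/F_0,\sigma,c)$ be an associative cyclic algebra over $F_0$ of degree $n$ (so $c\in F_0^\times$) such that $D=D_0\otimes_{F_0}F=(K/F,\sigma,c)$ is a division algebra. Assume that $m$ is prime and, in case $m\ne 2,3$, additionally that $F_0$ contains a primitive $m$th root of unity. Then $$(L/F_0,\sigma,c)\otimes_{F_0}(F/F_0,\tau,d)$$ is a division algebra if and only if $$d\ne z\,\widetilde\tau(z)\cdots\widetilde\tau^{m-1}(z)\quad\text{for all } z\in D.$$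
   Context: Algebras are unital but not necessarily associative. A nonzero algebra $A$ is a division algebra if for every $a\ne0$ in $A$ the left and right multiplications by $a$ are bijective. Cyclic algebras: for a cyclic Galois extension $E/k$ of degree $r$ with $\mathrm{Gal}(E/k)=\langle\rho\rangle$ and $a\in E^\times$, $(E/k,\rho,a)=E\oplus eE\oplus\dots\oplus e^{r-1}E$ is the $k$-algebra with biadditive multiplication, for $x,y\in E$, $0\le i,j<r$, $(e^ix)(e^jy)=e^{i+j}\rho^j(x)y$ if $i+j<r$, and $(e^ix)(e^jy)=e^{(i+j)-r}a\rho^j(x)y$ if $i+j\ge r$. It is associative if $a\in k^\times$ (an associative cyclic algebra), and is called a nonassociative cyclic algebra of degree $r$ if $a\in E\setminus k$. Extensions: $\sigma$ and $\tau$ are canonically extended to $K$: $\sigma$ is the identity on $F$, and $\tau$ is the identity on $L$. The map $\widetilde\tau$: on $D=(K/F,\sigma,c)$, $\widetilde\tau(\sum_i e^ix_i)=\sum_i e^i\tau(x_i)$ ($x_i\in K$); it is a ring automorphism of $D$ (it equals $\mathrm{id}_{D_0}\otimes\tau$ on $D_0\otimes_{F_0}F$). *)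

(* Defs.v *)
From HB Require Import structures.
From mathcomp Require Import all_boot all_order all_algebra all_fingroup all_field.

Set Implicit Arguments.
Unset Strict Implicit.
Unset Printing Implicit Defensive.

Import GRing.Theory.
Local Open Scope ring_scope.

(* Finite-dimensional unital algebras over a field, not necessarily
   associative. *)
Record naAlg (k : fieldType) := NaAlg {
  na_sort :> vectType k;
  na_mul : na_sort -> na_sort -> na_sort;
  na_one : na_sort;
  na_mul_linr : forall x, linear (na_mul x);
  na_mul_linl : forall y, linear (na_mul^~ y);
  na_mul1x : left_id na_one na_mul;
  na_mulx1 : right_id na_one na_mul
}.

Arguments na_one {k} _.

Definition division_alg (k : fieldType) (A : naAlg k) : Prop :=
  (exists x : A, x != 0) /\
  (forall a : A, a != 0 ->
     bijective (fun x => na_mul a x) /\ bijective (fun x => na_mul x a)).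

Section CyclicAlgebra.

Variables (k : fieldType) (E : fieldExtType k) (r : nat).
Variables (rho : 'AEnd(E)) (a : E).

(* [x : {ffun 'I_r -> E}] stands for \sum_i e^i (x i), with the coefficients
   from E on the right of the powers of e. *)
Definition cyc_mul (x y : {ffun 'I_r -> E}) : {ffun 'I_r -> E} :=
  [ffun l : 'I_r => \sum_(i < r) \sum_(j < r)
     (if (i + j == l)%N then iter j rho (x i) * y j
      else if (i + j == l + r)%N then a * iter j rho (x i) * y j
      else 0)].

Definition cyc_mon (i : 'I_r) (u : E) : {ffun 'I_r -> E} :=
  [ffun l => if l == i then u else 0].

Definition cyc_one : {ffun 'I_r -> E} := [ffun l : 'I_r => (l == 0 :> nat)%:R].

Lemma iter_rho_lin j : linear (iter j rho).
Proof. by elim: j => [|j IHj] b u v //=; rewrite IHj linearP. Qed.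

Lemma iter_rho0 j : iter j rho 0 = 0.
Proof. by elim: j => //= j ->; rewrite linear0. Qed.

Lemma iter_rho1 j : iter j rho 1 = 1.
Proof. by elim: j => //= j ->; rewrite rmorph1. Qed.

Lemma cyc_mul_linr x : linear (cyc_mul x).
Proof.
move=> b u v; apply/ffunP=> l; rewrite !ffunE scaler_sumr -big_split /=.
apply: eq_bigr => i _; rewrite scaler_sumr -big_split /=.
apply: eq_bigr => j _; rewrite !ffunE.
by do 2?[case: ifP => _]; rewrite ?mulrDr ?scalerAr ?scaler0 ?addr0.
Qed.

Lemma cyc_mul_linl y : linear (cyc_mul^~ y).
Proof.
move=> b u v; apply/ffunP=> l; rewrite !ffunE scaler_sumr -big_split /=.
apply: eq_bigr => i _; rewrite scaler_sumr -big_split /=.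
apply: eq_bigr => j _; rewrite !ffunE iter_rho_lin.
do 2?[case: ifP => _]; rewrite ?scaler0 ?addr0 //.
  by rewrite mulrDl -scalerAl.
by rewrite mulrDr mulrDl -scalerAr -scalerAl.
Qed.

Lemma cyc_mul_mon_lt (i j l : 'I_r) u v : (i + j = l)%N ->
  cyc_mul (cyc_mon i u) (cyc_mon j v) = cyc_mon l (iter j rho u * v).
Proof.
move=> ijl; apply/ffunP=> t; rewrite !ffunE (bigD1 i) //= (bigD1 j) //=.
rewrite !big1 ?addr0 => [|i' /negPf ne_i|j' /negPf ne_j].
- rewrite !ffunE !eqxx ijl (eq_sym t) -val_eqE; case: ifP => // _.
  by rewrite ifN //; apply: contraTneq (ltn_ord l) => ->; rewrite -leqNgt leq_addl.
- rewrite big1 // => j' _; rewrite !ffunE ne_i iter_rho0 !(mulr0, mul0r).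
  by do 2?case: ifP.
- by rewrite !ffunE ne_j !mulr0; do 2?case: ifP.
Qed.

Lemma cyc_mul_mon_ge (i j l : 'I_r) u v : (i + j = l + r)%N ->
  cyc_mul (cyc_mon i u) (cyc_mon j v) = cyc_mon l (a * iter j rho u * v).
Proof.
move=> ijl; apply/ffunP=> t; rewrite !ffunE (bigD1 i) //= (bigD1 j) //=.
rewrite !big1 ?addr0 => [|i' /negPf ne_i|j' /negPf ne_j].
- rewrite !ffunE !eqxx ijl ifN ?eqn_add2r ?(eq_sym t) //.
  by apply: contraTneq (ltn_ord t) => <-; rewrite -leqNgt leq_addl.
- rewrite big1 // => j' _; rewrite !ffunE ne_i iter_rho0 !(mulr0, mul0r).
  by do 2?case: ifP.
- by rewrite !ffunE ne_j !mulr0; do 2?case: ifP.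
Qed.

Lemma cyc_mul1x : left_id cyc_one cyc_mul.
Proof.
move=> y; apply/ffunP=> l; rewrite ffunE.
have r_gt0 : (0 < r)%N := leq_ltn_trans (leq0n l) (ltn_ord l).
rewrite (bigD1 (Ordinal r_gt0)) //= (bigD1 l) //= !big1 ?addr0.
- by rewrite !ffunE eqxx iter_rho1 mul1r.
- move=> i ne_i; rewrite big1 // => j _; rewrite !ffunE.
  by rewrite -val_eqE /= in ne_i; rewrite (negPf ne_i) iter_rho0 !(mulr0, mul0r); do 2?case: ifP.
- move=> j ne_j; rewrite add0n -[_ == _ :> nat]/(j == l) (negPf ne_j) ifN //.
  by apply: contraTneq (ltn_ord j) => ->; rewrite -leqNgt leq_addl.
Qed.

Lemma cyc_mulx1 : right_id cyc_one cyc_mul.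
Proof.
move=> x; apply/ffunP=> l; rewrite ffunE.
have r_gt0 : (0 < r)%N := leq_ltn_trans (leq0n l) (ltn_ord l).
rewrite exchange_big (bigD1 (Ordinal r_gt0)) //= (bigD1 l) //= !big1 ?addr0.
- by rewrite !ffunE addn0 eqxx mulr1.
- move=> j ne_j; rewrite big1 // => i _; rewrite !ffunE.
  by rewrite -val_eqE /= in ne_j; rewrite (negPf ne_j) !mulr0; do 2?case: ifP.
- move=> i ne_i; rewrite addn0 -[_ == _ :> nat]/(i == l) (negPf ne_i) ifN //.
  by apply: contraTneq (ltn_ord i) => ->; rewrite -leqNgt leq_addl.
Qed.

(* (E/k, rho, a) of degree r; meaningful when E/k is cyclic Galois of degree r,
   rho generates its Galois group and a is nonzero. *)
Definition cyclic_alg : naAlg k :=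
  NaAlg cyc_mul_linr cyc_mul_linl cyc_mul1x cyc_mulx1.

End CyclicAlgebra.

Section TensorProduct.

Variable k : fieldType.

Section Space.

Variables U V : vectType k.

(* The matrix M stands for \sum_(i, j) M i j *: (b_i (x) b'_j), where b and b'
   are the library bases of U and V; [tens_lift_pure] and [tens_ext] give the
   universal property. *)
Definition tens : vectType k := 'M[k]_(\dim {:U}, \dim {:V}).

Definition tens_pure (u : U) (v : V) : tens :=
  \matrix_(i, j) (coord (vbasis {:U}) i u * coord (vbasis {:V}) j v).

Definition tens_lift (W : zmodType) (f : U -> V -> W) (M : tens) : W :=
  \sum_i \sum_j f (M i j *: (vbasis {:U})`_i) (vbasis {:V})`_j.

Lemma tens_pure_linr u : linear (tens_pure u).
Proof. by move=> b v w; apply/matrixP=> i j; rewrite !mxE linearP /= mulrDr mulrCA. Qed.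

Lemma tens_pure_linl v : linear (tens_pure^~ v).
Proof. by move=> b u w; apply/matrixP=> i j; rewrite !mxE linearP /= mulrDl mulrA. Qed.

Lemma tens_decomp (M : tens) :
  M = \sum_i \sum_j tens_pure (M i j *: (vbasis {:U})`_i) (vbasis {:V})`_j.
Proof.
have freeU := basis_free (vbasisP {:U}); have freeV := basis_free (vbasisP {:V}).
apply/matrixP=> i j; rewrite summxE (bigD1 i) //= summxE (bigD1 j) //=.
rewrite !mxE linearZ /= !coord_free // !eqxx !mulr1.
rewrite !big1 ?addr0 // => [i' ne_i | j' ne_j].
  rewrite summxE big1 // => j' _; rewrite !mxE linearZ /= coord_free //.
  by rewrite (negPf ne_i) mulr0 mul0r.
rewrite !mxE coord_free // mulrC.
by rewrite (negPf ne_j) mul0r.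
Qed.

Lemma tens_lift_pure (W : zmodType) (f : U -> V -> W) :
    (forall u, zmod_morphism (f u)) -> (forall v, zmod_morphism (f^~ v)) ->
    (forall b u v, f (b *: u) v = f u (b *: v)) ->
  forall u v, tens_lift f (tens_pure u v) = f u v.
Proof.
move=> fr fl fb u v.
pose fU v := GRing.isZmodMorphism.Build U W (f^~ v) (fl v).
pose fV u := GRing.isZmodMorphism.Build V W (f u) (fr u).
pose FU v : {additive U -> W} := HB.pack (f^~ v) (fU v).
pose FV u : {additive V -> W} := HB.pack (f u) (fV u).
rewrite -[f u v]/(FU v u) {2}(coord_vbasis (memvf u)) raddf_sum /=.
apply: eq_bigr => i _; rewrite -[RHS]/(FV (_ *: _) v).
rewrite {2}(coord_vbasis (memvf v)) raddf_sum /=.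
by apply: eq_bigr => j _; rewrite mxE -fb scalerA mulrC.
Qed.

Lemma tens_lift_add (W : zmodType) (f : U -> V -> W) :
  (forall v, zmod_morphism (f^~ v)) -> zmod_morphism (tens_lift f).
Proof.
move=> fl M N; rewrite /tens_lift -sumrB; apply: eq_bigr => i _.
by rewrite -sumrB; apply: eq_bigr => j _; rewrite !mxE scalerBl fl.
Qed.

Lemma tens_ext (W : zmodType) (g h : {additive tens -> W}) :
  (forall u v, g (tens_pure u v) = h (tens_pure u v)) -> g =1 h.
Proof.
move=> gh M; rewrite (tens_decomp M) !raddf_sum; apply: eq_bigr => i _.
by rewrite !raddf_sum; apply: eq_bigr => j _; rewrite gh.
Qed.

End Space.

Variables A B : naAlg k.

Definition tens_mul (M N : tens A B) : tens A B :=
  tens_lift (fun a b => tens_lift (fun a' b' =>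
    tens_pure (na_mul a a') (na_mul b b')) N) M.

Definition tens_one : tens A B := tens_pure (na_one A) (na_one B).

Lemma tens_mulE (M N : tens A B) :
  tens_mul M N = \sum_i \sum_j \sum_p \sum_q (M i j * N p q) *:
    tens_pure (na_mul (vbasis {:A})`_i (vbasis {:A})`_p)
              (na_mul (vbasis {:B})`_j (vbasis {:B})`_q).
Proof.
have ml y c z : na_mul (c *: z : A) y = c *: na_mul z y.
  exact: (GRing.scalable_linear (@na_mul_linl _ A y)).
have mr y c z : na_mul y (c *: z : A) = c *: na_mul y z.
  exact: (GRing.scalable_linear (@na_mul_linr _ A y)).
have tl (y : B) c (z : A) : tens_pure (c *: z) y = c *: tens_pure z y.
  exact: (GRing.scalable_linear (tens_pure_linl y)).
rewrite /tens_mul /tens_lift; do 4![apply: eq_bigr => ? _].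
by rewrite ml mr scalerA tl.
Qed.

Lemma tens_mul_linr M : linear (tens_mul M).
Proof.
move=> b N P; rewrite !tens_mulE.
do 4![rewrite scaler_sumr -big_split /=; apply: eq_bigr => ? _].
by rewrite !mxE mulrDr scalerDl scalerA mulrCA.
Qed.

Lemma tens_mul_linl N : linear (tens_mul^~ N).
Proof.
move=> b M P; rewrite !tens_mulE.
do 4![rewrite scaler_sumr -big_split /=; apply: eq_bigr => ? _].
by rewrite !mxE mulrDl scalerDl scalerA mulrA.
Qed.

Lemma tens_mul_pure (a a' : A) (b b' : B) :
  tens_mul (tens_pure a b) (tens_pure a' b') =
  tens_pure (na_mul a a') (na_mul b b').
Proof.
have mlB (X : naAlg k) (y : X) := GRing.zmod_morphism_linear (@na_mul_linl k X y).
have mrB (X : naAlg k) (y : X) := GRing.zmod_morphism_linear (@na_mul_linr k X y).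
have mlZ (X : naAlg k) (y : X) := GRing.scalable_linear (@na_mul_linl k X y).
have mrZ (X : naAlg k) (y : X) := GRing.scalable_linear (@na_mul_linr k X y).
have tlB (v : B) := GRing.zmod_morphism_linear (@tens_pure_linl A B v).
have trB (u : A) := GRing.zmod_morphism_linear (@tens_pure_linr A B u).
have tlZ (v : B) := GRing.scalable_linear (@tens_pure_linl A B v).
have trZ (u : A) := GRing.scalable_linear (@tens_pure_linr A B u).
rewrite /tens_mul tens_lift_pure.
- rewrite tens_lift_pure // => [u v w|v u w|e u v].
  + by rewrite mrB trB.
  + by rewrite mrB tlB.
  + by rewrite !mrZ tlZ trZ.
- move=> u v w; rewrite /tens_lift -sumrB; apply: eq_bigr => p _.
  by rewrite -sumrB; apply: eq_bigr => q _; rewrite (mlB B) trB.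
- move=> v u w; rewrite /tens_lift -sumrB; apply: eq_bigr => p _.
  by rewrite -sumrB; apply: eq_bigr => q _; rewrite (mlB A) tlB.
- move=> e u v; apply: eq_bigr => p _; apply: eq_bigr => q _.
  by rewrite (mlZ A) (mlZ B) tlZ trZ.
Qed.

Lemma tens_mul1x : left_id tens_one tens_mul.
Proof.
pose g : {additive tens A B -> tens A B} := HB.pack (tens_mul tens_one)
  (GRing.isZmodMorphism.Build _ _ _
     (GRing.zmod_morphism_linear (tens_mul_linr tens_one))).
apply: (@tens_ext A B _ g idfun) => u v /=.
by rewrite tens_mul_pure !na_mul1x.
Qed.

Lemma tens_mulx1 : right_id tens_one tens_mul.
Proof.
pose g : {additive tens A B -> tens A B} := HB.pack (tens_mul^~ tens_one)
  (GRing.isZmodMorphism.Build _ _ _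
     (GRing.zmod_morphism_linear (tens_mul_linl tens_one))).
apply: (@tens_ext A B _ g idfun) => u v /=.
by rewrite tens_mul_pure !na_mulx1.
Qed.

Definition tens_alg : naAlg k :=
  NaAlg tens_mul_linr tens_mul_linl tens_mul1x tens_mulx1.

End TensorProduct.

Section Composite.

Variables (F0 : fieldType) (L F : fieldExtType F0) (K : fieldExtType F).
Variable iL : {rmorphism L -> K}.

(* The F-algebra K contains F as the scalars y%:A and L through iL. *)
Definition composite_map : tens L F -> K :=
  tens_lift (fun (x : L) (y : F) => y *: iL x).

Definition linearly_disjoint : Prop := injective composite_map.

Definition is_composite : Prop := forall z : K, exists t, composite_map t = z.

End Composite.

(* \sum_i e^i x_i |-> \sum_i e^i f(x_i) *)
Definition cyc_map (k : fieldType) (E : fieldExtType k) (r : nat)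
    (rho : 'AEnd(E)) (a : E) (f : E -> E)
    (x : cyclic_alg r rho a) : cyclic_alg r rho a :=
  [ffun i => f ((x : {ffun 'I_r -> E}) i)].

Definition twisted_norm (k : fieldType) (A : naAlg k) (t : A -> A) (m : nat)
    (z : A) : A :=
  \big[@na_mul k A/na_one A]_(i < m) iter i t z.

(* Main.v *)
Require Import Defs.
From HB Require Import structures.
From mathcomp Require Import all_boot all_order all_algebra all_fingroup all_field.
From mathcomp Require Import ring.
Set Implicit Arguments.
Unset Strict Implicit.
Unset Printing Implicit Defensive.
Import GRing.Theory.
Local Open Scope ring_scope.

(** Write [A] for the tensor product, [theta] for the automorphism of [D] that
    applies [tauK] to the coefficients, and [R = D[t; theta]] for the twisted
    polynomial ring in which [x t = t theta(x)].  As [d] is central in [D] and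
    [theta^m = 1], the polynomial [f = t^m - d] commutes with [D], and sending
    [x (x) \sum_j e^j b_j] to [\sum_j t^j (x (x) b_j)] identifies [A] with the
    remainders of degree less than [m], multiplied modulo the left ideal [R f]
    ([tens_to_pmulM], [tens_to_pmulK], [pmul_to_tensK]).  All spaces have finite
    dimension over [F0], so [A] is a division algebra iff this product has no
    zero divisors.  The claim is thus that for [m] prime [f] has a proper factor
    iff it has a linear one, a linear factor being the same as a solution of
    [d = z theta(z) ... theta^(m-1)(z)].

    If [d] is the twisted norm of [a], then [t - a] kills an explicit nonzero
    remainder ([twnorm_zero_divisor]).

    Conversely, suppose that [g h = 0] with [g], [h] nonzero.  The left
    [R]-submodule [R h] of the module [M = R / R f] is proper, because the
    relation [g h = 0] bounds its dimension by [deg g] times that of [D]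
    ([zero_divisor_submod]).  So it suffices to find a twisted norm from a proper
    nonzero submodule [U] of [M], and a telescoping computation
    ([shift_congr_twnorm]) finds one in two cases.  If [U] has dimension less
    than [2 \dim D], then the lines [D v] and [D t v], for [v] nonzero in [U],
    are not independent, which yields an eigenvector [t v = a v]
    ([small_submod_twnorm]).  If [U] has codimension less than [2 \dim D], then
    [U] meets [D + D t], so it contains some [t - a] ([large_submod_twnorm]).
    For [m = 2] and [m = 3] one of these always applies.

    For larger [m] a primitive root of unity [w] supplies the automorphism
    [t |-> w t] of [R], which fixes [f] and so acts on [M].  Let [U] be a minimal
    nonzero submodule.  The sum of its images under the powers of this
    automorphism is invariant, so it contains a monomial and is all of [M]
    ([twist_stable_full]).  Hence [M] is a sum of simple modules of dimension
    [\dim U], and [\dim U] divides [m \dim D]; likewise [U] is a sum of lines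
    over [D], and [\dim D] divides [\dim U].  As [m] is prime, [U] is [M] itself
    or a line over [D], and in the second case it is spanned by an eigenvector
    ([prime_root_submod_full]). *)

(** * Dimension counts in vector spaces and algebras *)

Lemma zmod_morphism_sum (U V : zmodType) (f : U -> V) : zmod_morphism f ->
  forall I (s : seq I) (F : I -> U),
    f (\sum_(i <- s) F i) = \sum_(i <- s) f (F i).
Proof.
move=> fB I s F; exact: (raddf_sum (HB.pack_for {additive U -> V} f
  (GRing.isZmodMorphism.Build U V f fB))).
Qed.

Lemma ffun_neq0 (I : finType) (V : zmodType) (v : {ffun I -> V}) :
  v != 0 -> exists i, v i != 0.
Proof.
move=> nz_v; apply/existsP; apply: contraNT nz_v.
rewrite negb_exists => /forallP v0; apply/eqP/ffunP=> i; rewrite ffunE.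
by apply/eqP; have:= v0 i; rewrite negbK.
Qed.

Lemma vspace_neq0 (k : fieldType) (V : vectType k) (U : {vspace V}) :
  U != 0%VS -> exists2 v, v \in U & v != 0.
Proof. by move=> nzU; exists (vpick U); rewrite ?memv_pick ?vpick0. Qed.

Lemma vspace_cap_neq0 (k : fieldType) (V : vectType k) (U W X : {vspace V}) :
  (U <= X)%VS -> (W <= X)%VS -> (\dim X < \dim U + \dim W)%N ->
  exists v, [/\ v != 0, v \in U & v \in W].
Proof.
move=> sUX sWX ltX; have [|v] := @vspace_neq0 _ _ (U :&: W)%VS.
  apply: contraTneq ltX => cap0; rewrite -leqNgt -dimv_sum_cap cap0 dimv0 addn0.
  by apply: dimvS; rewrite subv_add sUX.
by rewrite memv_cap => /andP[Uv Wv] nz_v; exists v.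
Qed.

(** The lower bound makes each [S i] simple among the subspaces satisfying [P]:
    adding it to a partial sum changes nothing or adds [s] to the dimension. *)
Lemma dvdn_dim_sumv (k : fieldType) (V : vectType k)
    (P : {vspace V} -> Prop) (s : nat) (I : Type) (r : seq I)
    (S : I -> {vspace V}) :
    P 0%VS -> (forall U W, P U -> P W -> P (U + W)%VS) ->
    (forall U W, P U -> P W -> P (U :&: W)%VS) ->
    (forall U, P U -> U != 0%VS -> (s <= \dim U)%N) ->
    (forall i, P (S i)) -> (forall i, \dim (S i) = s) ->
  (s %| \dim (\sum_(i <- r) S i)%VS)%N.
Proof.
move=> P0 PD PI Pmin PS dimS.
elim: r => [|i r IHr]; first by rewrite big_nil dimv0 dvdn0.
have PR: P (\sum_(j <- r) S j)%VS by apply: big_ind.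
rewrite big_cons; set R := (\sum_(j <- r) S j)%VS in IHr PR *.
have dim_sum := dimv_sum_cap (S i) R; rewrite dimS in dim_sum.
have [cap0 | nz_cap] := eqVneq (S i :&: R)%VS 0%VS.
  by rewrite cap0 dimv0 addn0 in dim_sum; rewrite dim_sum dvdn_addr.
have /eqP eq_cap: (S i :&: R)%VS == S i.
  by rewrite eqEdim capvSl dimS Pmin //; apply: PI.
by rewrite eq_cap dimS addnC in dim_sum; rewrite (addnI dim_sum).
Qed.

(** In finite dimension the injective one-sided multiplications are bijective. *)
Lemma division_alg_domain (k : fieldType) (A : naAlg k) :
    (exists x : A, x != 0) ->
    (forall x y : A, na_mul x y = 0 -> x = 0 \/ y = 0) ->
  division_alg A.
Proof.
move=> nzA domA; split=> // a nz_a.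
have inj_bij (f : A -> A) :
    linear f -> (forall x, f x = 0 -> x = 0) -> bijective f.
  move=> lin_f f0.
  pose g : {linear A -> A} := HB.pack f (GRing.isLinear.Build k A A _ f lin_f).
  have ker0 : lker (linfun g) == 0%VS.
    rewrite -subv0; apply/subvP=> x; rewrite memv_ker lfunE memv0 => /eqP/f0->.
    by rewrite eqxx.
  exists (linfun g)^-1%VF => x; first by have:= lker0_lfunK ker0 x; rewrite lfunE.
  by have:= lker0_lfunVK ker0 x; rewrite lfunE.
split; apply: inj_bij; [exact: na_mul_linr | | exact: na_mul_linl |].
  by move=> x /domA[] // a0; rewrite a0 eqxx in nz_a.
by move=> x /domA[] // a0; rewrite a0 eqxx in nz_a.
Qed.

(** * Iterates of morphisms *)

Fact iter_is_zmod_morphism (V : zmodType) (f : {additive V -> V}) i :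
  zmod_morphism (iter i f).
Proof. by elim: i => [|i IHi] u v //=; rewrite IHi raddfB. Qed.
HB.instance Definition _ (V : zmodType) (f : {additive V -> V}) i :=
  GRing.isZmodMorphism.Build V V (iter i f) (iter_is_zmod_morphism f i).

Fact iter_is_scalable (k : pzRingType) (V : lmodType k) (f : {linear V -> V}) i :
  scalable (iter i f).
Proof. by elim: i => [|i IHi] b v //=; rewrite IHi linearZ. Qed.
HB.instance Definition _ (k : pzRingType) (V : lmodType k)
    (f : {linear V -> V}) i :=
  GRing.isScalable.Build k V V *:%R (iter i f) (iter_is_scalable f i).

Fact iter_is_monoid_morphism (R : pzRingType) (f : {rmorphism R -> R}) i :
  monoid_morphism (iter i f).
Proof.
split=> [|x y]; elim: i => //= i ->; [exact: rmorph1 | exact: rmorphM].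
Qed.
HB.instance Definition _ (R : pzRingType) (f : {rmorphism R -> R}) i :=
  GRing.isMonoidMorphism.Build R R (iter i f) (iter_is_monoid_morphism f i).

(** * The module of remainders modulo [t^m - d] over a division algebra *)

Section PetitModule.

Variables (k : fieldType) (D : falgType k) (p : nat).
Variables (theta : {lrmorphism D -> D}) (d : D).

Hypothesis divD : forall x : D, x != 0 -> x \is a GRing.unit.
Hypothesis thetam : iter p.+1 theta =1 id.
Hypothesis dC : forall x, d * x = x * d.

Local Notation m := p.+1.
Local Notation M := {ffun 'I_p.+1 -> D}.
Local Notation th i := (iter i theta).

(** The tuple [v] stands for the class of [\sum_i t^i v_i] in [R / R f], where
    [R = D[t; theta]] and [f = t^m - d]; [shift] is the left multiplication by
    [t].  The class of [t^m x] is that of [d x], because [f x = x f]. *)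
Definition shift (v : M) : M :=
  [ffun i : 'I_m => if i == 0 :> nat then d * v ord_max else v (inord i.-1)].

(** Left multiplication by [x], moved past the powers of [t] by
    [x t^i = t^i theta^i(x)]. *)
Definition act (x : D) (v : M) : M := [ffun i : 'I_m => th i x * v i].

Fact shift_is_linear : linear shift.
Proof.
move=> b u v; apply/ffunP=> i; rewrite !ffunE.
by case: ifP; rewrite ?ffunE // mulrDr scalerAr.
Qed.
HB.instance Definition _ := GRing.isLinear.Build k M M *:%R shift shift_is_linear.

Fact act_is_linear x : linear (act x).
Proof. by move=> b u v; apply/ffunP=> i; rewrite !ffunE mulrDr scalerAr. Qed.
HB.instance Definition _ x :=
  GRing.isLinear.Build k M M *:%R (act x) (act_is_linear x).

Lemma act_linearl v : linear (act^~ v).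
Proof.
by move=> b x y; apply/ffunP=> i; rewrite !ffunE linearP mulrDl scalerAl.
Qed.

Lemma actBl v x y : act (x - y) v = act x v - act y v.
Proof. exact: (GRing.zmod_morphism_linear (act_linearl v)). Qed.

Lemma act0l v : act 0 v = 0.
Proof. by rewrite -[in LHS](subrr 0) actBl subrr. Qed.

Lemma actNl v x : act (- x) v = - act x v.
Proof. by rewrite -[- x]sub0r actBl act0l sub0r. Qed.

Lemma act1 v : act 1 v = v.
Proof. by apply/ffunP=> i; rewrite !ffunE rmorph1 mul1r. Qed.

Lemma actM x y v : act (x * y) v = act x (act y v).
Proof. by apply/ffunP=> i; rewrite !ffunE rmorphM mulrA. Qed.

Lemma act_inj x : x != 0 -> injective (act x).
Proof.
move=> nz_x u v eq_uv; rewrite -[u]act1 -[v]act1 -(mulVr (divD nz_x)) !actM.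
by rewrite eq_uv.
Qed.

Lemma act_eq0 x v : (act x v == 0) = (x == 0) || (v == 0).
Proof.
have [-> | nz_x] := eqVneq x 0; first by rewrite act0l eqxx.
by rewrite -{1}(linear0 (act x)) (inj_eq (act_inj nz_x)).
Qed.

(** The rule [x t = t theta(x)]; at the coordinate where [t^m] is reduced it
    needs [theta^m = 1] and the centrality of [d]. *)
Lemma act_shift x v : act x (shift v) = shift (act (theta x) v).
Proof.
apply/ffunP=> i; rewrite !ffunE.
case: ifPn => [/eqP-> | nz_i]; first by rewrite -iterSr thetam !mulrA -dC.
have ltim: (i.-1 < m)%N by rewrite (leq_ltn_trans (leq_pred _)).
by rewrite -iterSr inordK // prednK // lt0n.
Qed.

Lemma act_iter_shift j x v :
  act x (iter j shift v) = iter j shift (act (th j x) v).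
Proof.
elim: j x => //= j IHj x.
by rewrite act_shift IHj -iterSr.
Qed.

Lemma iter_shiftE j v (i : 'I_m) : (j <= m)%N ->
  iter j shift v i =
    if (j <= i)%N then v (inord (i - j)) else d * v (inord (i + m - j)).
Proof.
elim: j i => [|j IHj] i ltjm; first by rewrite subn0 inord_val.
have lejm := ltnW ltjm; rewrite iterS ffunE; case: ifPn => [/eqP-> | nz_i].
  by rewrite IHj // add0n subSS ifT //= addnC -addnBA ?subnn //= addnK.
have i_gt0: (0 < i)%N by rewrite lt0n.
have ltim: (i.-1 < m)%N by rewrite (leq_ltn_trans (leq_pred _)).
rewrite IHj // inordK // -[in RHS](prednK i_gt0) ltnS.
by rewrite subSS addSn subSS.
Qed.

Lemma iter_shiftm v : iter m shift v = [ffun i => d * v i].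
Proof.
by apply/ffunP=> i; rewrite iter_shiftE // ffunE leqNgt ltn_ord addnK inord_val.
Qed.

Definition twnorm j x := \prod_(i < j) th i x.

Lemma twnormS j x : twnorm j.+1 x = x * theta (twnorm j x).
Proof. by rewrite /twnorm big_ord_recl rmorph_prod. Qed.

Lemma twnormSr j x : twnorm j.+1 x = twnorm j x * th j x.
Proof. by rewrite /twnorm big_ord_recr. Qed.

Lemma theta_twnorm i j x : th i (twnorm j x) = twnorm j (th i x).
Proof.
rewrite /twnorm rmorph_prod; apply: eq_bigr => l _ /=.
by rewrite -!iterD addnC.
Qed.

Definition act_stable (U : {vspace M}) : Prop :=
  forall x v, v \in U -> act x v \in U.

Definition submod (U : {vspace M}) : Prop :=
  act_stable U /\ (forall v, v \in U -> shift v \in U).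

Lemma act_stable0 : act_stable 0%VS.
Proof. by move=> x v; rewrite !memv0 => /eqP->; rewrite linear0. Qed.

Lemma act_stableD U W : act_stable U -> act_stable W -> act_stable (U + W)%VS.
Proof.
move=> aU aW x _ /memv_addP[u Uu [v Wv ->]].
by rewrite linearD memv_add ?aU ?aW.
Qed.

Lemma act_stableI U W : act_stable U -> act_stable W -> act_stable (U :&: W)%VS.
Proof.
by move=> aU aW x v; rewrite !memv_cap => /andP[Uv Wv]; rewrite aU ?aW.
Qed.

Lemma submod0 : submod 0%VS.
Proof.
split=> [|v]; first exact: act_stable0.
by rewrite !memv0 => /eqP->; rewrite linear0.
Qed.

Lemma submodD U W : submod U -> submod W -> submod (U + W)%VS.
Proof.
move=> [aU sU] [aW sW]; split; first exact: act_stableD.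
by move=> _ /memv_addP[u Uu [v Wv ->]]; rewrite linearD memv_add ?sU ?sW.
Qed.

Lemma submodI U W : submod U -> submod W -> submod (U :&: W)%VS.
Proof.
move=> [aU sU] [aW sW]; split; first exact: act_stableI.
by move=> v; rewrite !memv_cap => /andP[Uv Wv]; rewrite sU ?sW.
Qed.

Lemma iter_shift_sub U j v : submod U -> v \in U -> iter j shift v \in U.
Proof. by case=> _ sU Uv; elim: j => //= j /sU. Qed.

(** A congruence [t v = a v] modulo [U] lets one replace [t] by [a] repeatedly in
    [t^m v].  With [N_j] the product of the first [j] factors of the norm of
    [theta(a)], the difference
    [N_j t^(m-j) v - N_(j+1) t^(m-j-1) v] is [N_j t^(m-j-1) (t v - a v)], since
    moving [theta^(j+1)(a)] to the right of [t^(m-j-1)] turns it into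
    [theta^m(a) = a]. *)
Lemma shift_congr_twnorm U v a : submod U -> shift v - act a v \in U ->
  iter m shift v - act (twnorm m (theta a)) v \in U.
Proof.
move=> Usub Ua; have actU := Usub.1.
suffices claim j : (j <= m)%N ->
    iter m shift v - act (twnorm j (theta a)) (iter (m - j) shift v) \in U.
  by have:= claim m (leqnn _); rewrite subnn.
elim: j => [|j IHj] ltjm; first by rewrite /twnorm big_ord0 act1 subn0 subrr mem0v.
rewrite -(subrK (act (twnorm j (theta a)) (iter (m - j) shift v)) (iter m shift v)).
rewrite -addrA memvD ?IHj ?(ltnW ltjm) // twnormSr actM -linearB actU //=.
rewrite act_iter_shift -(subnSK ltjm) -iterSr -iterD subnK // thetam.
by rewrite iterSr -linearB iter_shift_sub.
Qed.

Definition mon0 (x : D) : M := [ffun j : 'I_m => if j == 0 :> nat then x else 0].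

Local Notation e0 := (mon0 1%R).

Lemma act_mon0 x y : act x (mon0 y) = mon0 (x * y).
Proof.
apply/ffunP=> i; rewrite !ffunE; case: ifP => [/eqP-> // | _].
by rewrite mulr0.
Qed.

Lemma mon0_eq0 x : (mon0 x == 0) = (x == 0).
Proof.
apply/eqP/eqP => [/ffunP/(_ ord0) | ->]; first by rewrite !ffunE eqxx.
by apply/ffunP=> i; rewrite !ffunE if_same.
Qed.

Lemma iter_shift_mon0 i x : (i < m)%N ->
  iter i shift (mon0 x) = [ffun l : 'I_m => if l == i :> nat then x else 0].
Proof.
move=> ltim; apply/ffunP=> l; rewrite iter_shiftE ?(ltnW ltim) // !ffunE.
have [leil | ltli] := leqP i l.
  rewrite inordK ?(leq_ltn_trans (leq_subr _ _)) // subn_eq0.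
  by rewrite [in RHS]eqn_leq leil andbT.
have lt_lm : (l + m - i < m)%N by rewrite ltn_subLR ?ltn_add2r // ltnW ?ltn_addl.
rewrite inordK // subn_eq0 leqNgt ltn_addl //= mulr0.
by rewrite (ltn_eqF ltli).
Qed.

Lemma ffun_sum_mon0 (v : M) : v = \sum_(i < m) iter i shift (mon0 (v i)).
Proof.
apply/ffunP=> l; rewrite sum_ffunE (bigD1 l) //= iter_shift_mon0 // ffunE eqxx.
rewrite big1 ?addr0 // => i /negPf ne_il; rewrite iter_shift_mon0 // ffunE.
by rewrite eq_sym -[_ == _ :> nat]/(i == l) ne_il.
Qed.

(** A nonzero constant is invertible, so [1] lies in [U], and [1] generates [M]. *)
Lemma submod_mon0_full U x : submod U -> x != 0 -> mon0 x \in U -> U = fullv.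
Proof.
move=> Usub nz_x Ux; apply/vspaceP=> v; rewrite memvf.
rewrite (ffun_sum_mon0 v) memv_suml // => i _; apply: iter_shift_sub => //.
by rewrite -(mulr1 (v i)) -(mulVr (divD nz_x)) mulrA -act_mon0; apply: Usub.1.
Qed.

(** On [M], [t^m] multiplies every coordinate by [d] on the left, whereas the left
    multiplication by the norm [N] acts on coordinate [i] as [theta^i(N)], itself
    the norm of [theta^(i+1)(a)]. *)
Lemma eigenvector_twnorm v a : v != 0 -> shift v = act a v ->
  exists z, d = twnorm m z.
Proof.
move=> nz_v Tv.
have: shift v - act a v \in 0%VS by rewrite Tv subrr mem0v.
move/(shift_congr_twnorm submod0); rewrite memv0 iter_shiftm subr_eq0 => /eqP eq_v.
have [i nz_vi] := ffun_neq0 nz_v.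
exists (th i (theta a)); move/ffunP/(_ i): eq_v; rewrite !ffunE theta_twnorm.
exact: (mulIr (divD nz_vi)).
Qed.

(** Applied to the class of [1], whose image under [t^m] is [d], the telescoping
    puts the constant [d - N] in [U]. *)
Lemma coeigenvector_twnorm U a : submod U -> U != fullv ->
  shift e0 - act a e0 \in U -> exists z, d = twnorm m z.
Proof.
move=> Usub properU /(shift_congr_twnorm Usub).
have ->: iter m shift e0 = act d e0.
  rewrite act_mon0 iter_shiftm mulr1; apply/ffunP=> i; rewrite !ffunE.
  by case: ifP => _; rewrite ?mulr1 ?mulr0.
rewrite -actBl act_mon0 mulr1 => Ud; exists (theta a); apply/eqP.
rewrite -subr_eq0; apply: contraNT properU => nz_dN.
exact/eqP/(submod_mon0_full Usub nz_dN Ud).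
Qed.

(** * Submodules of small dimension or small codimension *)

Definition act_on (v : M) (x : D) : M := act x v.
HB.instance Definition _ v :=
  GRing.isLinear.Build k D M *:%R (act_on v) (act_linearl v).

Definition Dline (v : M) : {vspace M} := limg (linfun (act_on v)).

Lemma DlineP u v : reflect (exists x, u = act x v) (u \in Dline v).
Proof.
apply: (iffP memv_imgP) => [[x _ ->] | [x ->]]; exists x;
  by rewrite ?lfunE ?memvf.
Qed.

Lemma mem_Dline v : v \in Dline v.
Proof. by apply/DlineP; exists 1; rewrite act1. Qed.

Lemma Dline_act x v u : u \in Dline v -> act x u \in Dline v.
Proof. by case/DlineP=> y ->; apply/DlineP; exists (x * y); rewrite actM. Qed.

Lemma dim_Dline v : v != 0 -> \dim (Dline v) = \dim {:D}.
Proof.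
move=> nz_v; apply: limg_dim_eq; apply/eqP; rewrite -subv0; apply/subvP=> x.
rewrite memv_cap memv_ker lfunE memvf memv0 /= /act_on act_eq0.
by rewrite (negPf nz_v) orbF.
Qed.

Lemma dim_Dline_le v : (\dim (Dline v) <= \dim {:D})%N.
Proof. by rewrite -(limg_ker_dim (linfun (act_on v)) fullv) leq_addl. Qed.

Lemma dimM : \dim {:M} = (m * \dim {:D})%N.
Proof. by rewrite !dimvf /dim /= card_ord. Qed.

Lemma Dline_sub U v : act_stable U -> v \in U -> (Dline v <= U)%VS.
Proof. by move=> actU Uv; apply/subvP=> _ /DlineP[x ->]; apply: actU. Qed.

(** Both [D v] and [D t v] lie in [U] and cannot be independent, so
    [x v = y t v] for some nonzero [y]. *)
Lemma small_submod_twnorm U : submod U -> U != 0%VS -> (\dim U < 2 * \dim {:D})%N ->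
  exists z, d = twnorm m z.
Proof.
move=> Usub /vspace_neq0[v Uv nz_v] ltU.
have [Tv0 | nz_Tv] := eqVneq (shift v) 0.
  by apply: (eigenvector_twnorm (a := 0) nz_v); rewrite act0l.
have UTv: shift v \in U := Usub.2 v Uv.
have [] := vspace_cap_neq0 (Dline_sub Usub.1 Uv) (Dline_sub Usub.1 UTv).
  by rewrite !dim_Dline // addnn -mul2n.
move=> u [nz_u /DlineP[x def_u] /DlineP[y def_u']].
have nz_y: y != 0 by apply: contraNneq nz_u => y0; rewrite def_u' y0 act0l.
apply: (eigenvector_twnorm (a := y^-1 * x) nz_v); apply: (act_inj nz_y).
by rewrite -def_u' -actM mulVKr ?divD.
Qed.

(** Every nonzero subspace stable under [D] contains a line, so lines are simple
    and [U] is the sum of those through its basis vectors. *)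
Lemma dvdn_dim_act_stable U : act_stable U -> (\dim {:D} %| \dim U)%N.
Proof.
move=> actU.
have memb (i : 'I_(\dim U)) : (vbasis U)`_i \in vbasis U.
  by rewrite mem_nth ?size_tuple.
have -> : U = (\sum_(i < \dim U) Dline (vbasis U)`_i)%VS.
  apply: subv_anti; apply/andP; split.
    apply/subvP=> v /coord_vbasis->; apply: memv_sumr => i _.
    by rewrite memvZ ?mem_Dline.
  by apply/subv_sumP=> i _; rewrite Dline_sub ?vbasis_mem.
apply: (dvdn_dim_sumv _ act_stable0 act_stableD act_stableI).
- move=> W actW /vspace_neq0[v Wv nz_v]; rewrite -(dim_Dline nz_v).
  by rewrite dimvS ?Dline_sub.
- by move=> i x v; apply: Dline_act.
by move=> i; apply: dim_Dline; apply: (free_not0 (basis_free (vbasisP U))).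
Qed.

(** By dimension [U] meets [D + D t] in some nonzero [x + y t], where [y] is not
    zero because a proper submodule contains no nonzero constant. *)
Lemma large_submod_twnorm U : (1 < m)%N -> submod U -> U != fullv ->
  (m * \dim {:D} < \dim U + 2 * \dim {:D})%N -> exists z, d = twnorm m z.
Proof.
move=> m_gt1 Usub properU ltU.
have nz1: e0 != 0 by rewrite mon0_eq0 oner_eq0.
have T1E: shift e0 = [ffun l : 'I_m => if l == 1 :> nat then 1 else 0].
  exact: (iter_shift_mon0 _ m_gt1).
have nzT1: shift e0 != 0.
  apply/eqP; rewrite T1E => /ffunP/(_ (Ordinal m_gt1))/eqP.
  by rewrite !ffunE oner_eq0.
have cap0: (Dline e0 :&: Dline (shift e0) = 0)%VS.
  apply/eqP; rewrite -subv0; apply/subvP=> u; rewrite memv_cap memv0.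
  case/andP=> /DlineP[x ->] /DlineP[y]; rewrite act_mon0 T1E => /ffunP/(_ ord0).
  by rewrite !ffunE !mulr1 mulr0 /= mon0_eq0 => ->.
have [] := @vspace_cap_neq0 _ _ U (Dline e0 + Dline (shift e0))%VS _
             (subvf _) (subvf _).
  rewrite dimM (leq_trans ltU) // leq_add2l.
  have:= dimv_sum_cap (Dline e0) (Dline (shift e0)).
  by rewrite cap0 dimv0 addn0 !dim_Dline // => ->; rewrite mul2n addnn.
move=> u [nz_u Uu /memv_addP[_ /DlineP[x ->] [_ /DlineP[y ->] def_u]]].
have nz_y: y != 0.
  apply: contraNneq properU => y0; rewrite y0 act0l addr0 in def_u.
  have nz_x: x != 0 by apply: contraNneq nz_u => x0; rewrite def_u x0 act0l.
  by rewrite def_u act_mon0 mulr1 in Uu; apply/eqP/(submod_mon0_full Usub nz_x Uu).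
apply: (coeigenvector_twnorm (a := - (y^-1 * x)) Usub properU).
rewrite actNl opprK.
have ->: shift e0 + act (y^-1 * x) e0 = act y^-1 u.
  by rewrite def_u linearD /= -!actM mulVr ?divD // act1 addrC.
exact: Usub.1.
Qed.


(** * Zero divisors and submodules *)

(** The remainder of the product of two polynomials of degree less than [m]
    modulo the left ideal [R f]: the action of the polynomial [g] on the class of
    [h]. *)
Definition pmul (g h : M) : M := \sum_(i < m) iter i shift (act (g i) h).

Lemma pmul_zmod_morphismr g : zmod_morphism (pmul g).
Proof.
by move=> u v; rewrite /pmul -sumrB; apply: eq_bigr => i _; rewrite !linearB.
Qed.

Lemma pmul_zmod_morphisml h : zmod_morphism (pmul^~ h).
Proof.
move=> u v; rewrite /pmul -sumrB; apply: eq_bigr => i _.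
by rewrite !ffunE actBl linearB.
Qed.

Lemma pmulE g h : pmul g h = [ffun l : 'I_m => \sum_(i < m) \sum_(j < m)
  (if (i + j == l)%N then th j (g i) * h j
   else if (i + j == l + m)%N then d * th j (g i) * h j else 0)].
Proof.
apply/ffunP=> l; rewrite /pmul sum_ffunE ffunE; apply: eq_bigr => i _.
rewrite (iter_shiftE _ _ (ltnW (ltn_ord i))); have [leil | ltli] := leqP i l.
  have lt_lm : (l - i < m)%N := leq_ltn_trans (leq_subr _ _) (ltn_ord l).
  rewrite (bigD1 (inord (l - i))) //= big1 => [|j ne_j].
    by rewrite addr0 !inordK // subnKC // eqxx !ffunE inordK.
  rewrite !ifN //.
    apply: contraTneq (ltn_ord j) => eq_ij.
    by rewrite -leqNgt -(leq_add2l i) eq_ij leq_add2r.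
  by apply: contraNneq ne_j => <-; rewrite addKn inord_val.
have lt_lm : (l + m - i < m)%N by rewrite ltn_subLR ?ltn_add2r // ltnW ?ltn_addl.
have le_im : (i <= l + m)%N by rewrite ltnW // ltn_addl.
rewrite (bigD1 (inord (l + m - i))) //= big1 => [|j ne_j].
  rewrite addr0 !inordK // subnKC // eqxx !ffunE inordK // mulrA ifN //.
  by rewrite -[X in _ != X]addn0 eqn_add2l.
rewrite !ifN //.
  by apply: contraNneq ne_j => <-; rewrite addKn inord_val.
by apply: contraTneq ltli => <-; rewrite -leqNgt leq_addr.
Qed.

Definition shift_Dline j v := (linfun (iter j shift) @: Dline v)%VS.

Lemma shift_DlineP j v u :
  reflect (exists x, u = iter j shift (act x v)) (u \in shift_Dline j v).
Proof.
apply: (iffP memv_imgP) => [[_ /DlineP[x ->] ->] | [x ->]].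
  by exists x; rewrite lfunE.
by exists (act x v); rewrite ?lfunE //; apply/DlineP; exists x.
Qed.

Lemma dim_shift_Dline_le j v : (\dim (shift_Dline j v) <= \dim {:D})%N.
Proof.
rewrite (leq_trans _ (dim_Dline_le v)) //.
by rewrite -(limg_ker_dim (linfun (iter j shift)) (Dline v)) leq_addl.
Qed.

(** With [e] the degree of [g], the relation [g h = 0] writes [t^e x h], for every
    [x] in [D], through the lower powers of [t].  Hence [R h] is the sum of the
    [t^i D h] with [i < e], and has dimension at most [e * \dim D]. *)
Lemma zero_divisor_submod g h : g != 0 -> h != 0 -> pmul g h = 0 ->
  exists U, [/\ submod U, U != 0%VS & U != fullv].
Proof.
move=> nz_g nz_h gh0.
have [i0 nz_gi0] := ffun_neq0 nz_g.
case: (@arg_maxnP _ i0 (fun i => g i != 0) (fun i => i : nat) nz_gi0).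
move=> e nz_ge max_e.
pose U := (\sum_(i < e) shift_Dline i h)%VS.
have memU (i : nat) x : (i < e)%N -> iter i shift (act x h) \in U.
  move=> ltie; rewrite (subvP (sumv_sup (Ordinal ltie) _ (subvv _))) //.
  by apply/shift_DlineP; exists x.
have actU x v : v \in U -> act x v \in U.
  case/memv_sumP=> vs Uvs ->; rewrite linear_sum memv_suml // => i _.
  have /shift_DlineP[y ->] := Uvs i isT.
  by rewrite /= act_iter_shift -actM memU.
(* Solve the relation for its top term: multiply it by the scalar that turns the
   leading coefficient [g e] into [x]. *)
have memUe x : iter e shift (act x h) \in U.
  have: act (th (m - e) (x * (g e)^-1)) (pmul g h) \in U.
    by rewrite gh0 linear0 mem0v.
  rewrite /pmul (bigD1 e) //= linearD /= act_iter_shift -actM -iterD.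
  rewrite subnKC ?(ltnW (ltn_ord e)) // thetam mulrVK ?divD //.
  rewrite rpredDr // linear_sum memv_suml // => i ne_ie.
  have [lt_ie | le_ei] := ltnP i e; first by apply: actU; apply: memU.
  have -> : g i = 0.
    apply/eqP; apply: contraNT ne_ie => nz_gi.
    by rewrite -val_eqE eqn_leq le_ei andbT; exact: max_e.
  by rewrite act0l !linear0 mem0v.
exists U; split.
- split=> // v /memv_sumP[vs Uvs ->]; rewrite linear_sum memv_suml // => i _.
  have /shift_DlineP[y ->] := Uvs i isT; rewrite -iterS.
  have:= ltn_ord i; rewrite leq_eqVlt => /predU1P[-> // | ]; exact: memU.
- apply: contraNneq nz_h => U0; rewrite -memv0 -U0 -(act1 h).
  case: (posnP e) => [e_0 | e_gt0]; last exact: (memU 0%N).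
  by have:= memUe 1%R; rewrite e_0.
apply/eqP=> Ufull; have: (\dim U < \dim {:M})%N; last by rewrite Ufull ltnn.
have le1 := @dimv_leq_sum k M _ (index_enum 'I_e) xpredT
              (fun i : 'I_e => shift_Dline i h).
apply: (leq_ltn_trans le1).
apply: (@leq_ltn_trans (\sum_(i < e) \dim {:D})%N).
  by apply: leq_sum => i _; apply: dim_shift_Dline_le.
by rewrite dimM sum_nat_const card_ord ltn_pmul2r ?adim_gt0.
Qed.

(** The cofactor [h] is obtained by solving [t h = a h] downwards from the top
    coefficient [1]; the equation at coefficient [0] is then [d = twnorm m a].
    The zero divisor is [t - a]. *)
Lemma twnorm_zero_divisor a : (1 < m)%N -> d = twnorm m a ->
  exists g h, [/\ g != 0, h != 0 & pmul g h = 0].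
Proof.
move=> m_gt1 def_d.
pose i1 := Ordinal m_gt1.
pose g : M :=
  [ffun i : 'I_m => if i == ord0 then - a else if i == i1 then 1 else 0].
pose h : M := [ffun i : 'I_m => th i.+1 (twnorm (p - i) a)].
exists g, h; split.
- by apply/eqP=> /ffunP/(_ i1)/eqP; rewrite !ffunE /= oner_eq0.
- apply/eqP=> /ffunP/(_ ord_max)/eqP.
  by rewrite !ffunE subnn /twnorm big_ord0 rmorph1 oner_eq0.
rewrite /pmul (bigD1 ord0) //= (bigD1 i1) //= big1
  => [|i /andP[/negPf ne_i0 /negPf ne_i1]].
  rewrite addr0 !ffunE /= act1 actNl; apply/eqP; rewrite addrC subr_eq0; apply/eqP.
  apply/ffunP=> i; rewrite !ffunE; case: ifPn => [/eqP-> | nz_i].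
    by rewrite subnn /twnorm big_ord0 rmorph1 mulr1 def_d subn0 twnormS.
  have i_gt0 : (0 < i)%N by rewrite lt0n.
  have ltim: (i.-1 < m)%N by rewrite (leq_ltn_trans (leq_pred _)).
  have eq_pi : (p - i.-1 = (p - i).+1)%N.
    by rewrite -subSS prednK // subSn // -ltnS.
  by rewrite !inordK // prednK // eq_pi twnormS rmorphM /= -iterSr.
by rewrite !ffunE ne_i0 ne_i1 act0l linear0.
Qed.

(** * Primitive roots of unity *)

Section RootOfUnity.

Variable w : k.
Hypothesis prim_w : m.-primitive_root w.
Hypothesis nz_d : d != 0.

(** The automorphism [t |-> w t] of [R] fixes [t^m - d] as [w^m = 1]. *)
Definition twist (v : M) : M := [ffun i : 'I_m => w ^+ i *: v i].

Fact twist_is_linear : linear twist.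
Proof.
by move=> b u v; apply/ffunP=> i; rewrite !ffunE scalerDr !scalerA mulrC.
Qed.
HB.instance Definition _ := GRing.isLinear.Build k M M *:%R twist twist_is_linear.

Lemma twist_act x v : twist (act x v) = act x (twist v).
Proof. by apply/ffunP=> i; rewrite !ffunE scalerAr. Qed.

Lemma twist_shift v : twist (shift v) = w *: shift (twist v).
Proof.
apply/ffunP=> i; rewrite !ffunE; case: ifPn => [/eqP-> | nz_i].
  by rewrite -scalerAr scalerA -exprS (prim_expr_order prim_w) expr0.
have i_gt0 : (0 < i)%N by rewrite lt0n.
have ltim: (i.-1 < m)%N by rewrite (leq_ltn_trans (leq_pred _)).
by rewrite inordK // scalerA -exprS prednK.
Qed.

Lemma iter_twistm v : iter m twist v = v.
Proof.
suffices tw j : iter j twist v = [ffun i : 'I_m => (w ^+ i) ^+ j *: v i].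
  rewrite tw; apply/ffunP=> i.
  by rewrite ffunE exprAC (prim_expr_order prim_w) expr1n scale1r.
elim: j => [|j IHj]; apply/ffunP=> i; first by rewrite ffunE expr0 scale1r.
by rewrite iterS IHj !ffunE scalerA exprS.
Qed.

(** The eigenvalues [w^i] of [twist] are distinct and its eigenspaces are the
    coordinate subspaces, so the projection to a coordinate is, up to a nonzero
    scalar, a polynomial in [twist].  A stable subspace therefore contains a
    nonzero monomial [t^i x]; multiplied by [t^(m-i)] it becomes the nonzero
    constant [d x]. *)
Lemma twist_stable_full U : submod U -> U != 0%VS ->
  (forall v, v \in U -> twist v \in U) -> U = fullv.
Proof.
move=> Usub /vspace_neq0[v Uv nz_v] twU.
have [i nz_vi] := ffun_neq0 nz_v.
(* The image of [v] under the product over [s] of the maps [twist - w^j]. *)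
pose filtered (s : seq 'I_m) : M :=
  [ffun l : 'I_m => \prod_(j <- s) (w ^+ l - w ^+ j) *: v l].
have filt s : filtered s \in U.
  elim: s => [|j s IHs].
    rewrite (_ : filtered _ = v) //; apply/ffunP=> l.
    by rewrite ffunE big_nil scale1r.
  have -> : filtered (j :: s) = twist (filtered s) - w ^+ j *: filtered s.
    apply/ffunP=> l.
    by rewrite !ffunE big_cons scalerA scalerA -scalerBl mulrBl.
  by rewrite memvB ?twU ?memvZ.
have := filt [seq j <- enum 'I_m | j != i]; rewrite /filtered.
set c := \prod_(j <- [seq j <- enum 'I_m | j != i]) (w ^+ i - w ^+ j).
have nz_c : c != 0.
  rewrite prodf_seq_neq0; apply/allP=> j; rewrite mem_filter => /andP[ne_ji _].
  rewrite subr_eq0 (eq_prim_root_expr prim_w) !modn_small //.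
  by rewrite eq_sym.
rewrite (_ : finfun _ = iter i shift (mon0 (c *: v i))).
  move/(iter_shift_sub (m - i) Usub); rewrite -iterD subnK 1?ltnW // iter_shiftm.
  rewrite (_ : finfun _ = mon0 (d * (c *: v i))).
    apply: submod_mon0_full => //; rewrite (mulrI_eq0 _ (mulrI (divD nz_d))).
    by rewrite scaler_eq0 negb_or nz_c.
  by apply/ffunP=> l; rewrite !ffunE; case: ifP; rewrite ?mulr0.
apply/ffunP=> l; rewrite iter_shift_mon0 // !ffunE.
rewrite -[_ == _ :> nat]/(l == i); case: eqVneq => [-> // | ne_li].
apply/eqP; rewrite scaler_eq0 prodf_seq_eq0 /=; apply/orP; left.
by apply/hasP; exists l; rewrite ?subrr ?eqxx // mem_filter ne_li mem_enum.
Qed.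

Lemma iter_twist_act i x v : iter i twist (act x v) = act x (iter i twist v).
Proof. by elim: i => //= i ->; rewrite twist_act. Qed.

Lemma iter_twist_shift i v :
  iter i twist (shift v) = w ^+ i *: shift (iter i twist v).
Proof.
elim: i => [|i IHi]; first by rewrite scale1r.
by rewrite iterS IHi linearZ /= twist_shift scalerA -exprSr.
Qed.

(** Strong induction reduces to [U] of least dimension among the nonzero
    submodules.  Its images under the powers of [twist] are then
    minimal as well and add up to [M]. *)
Lemma prime_root_submod_full U : prime m -> (forall z, d <> twnorm m z) ->
  submod U -> U != 0%VS -> U = fullv.
Proof.
move=> m_prime noN.
have [N] := ubnP (\dim U); elim: N U => // N IHN U /ltnSE leUN Usub nzU.
apply/eqP; apply: contraT => properU.
(* A smaller submodule would be all of [M] by induction. *)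
have minU W : submod W -> W != 0%VS -> (\dim U <= \dim W)%N.
  move=> Wsub nzW; rewrite leqNgt; apply: contra properU => ltWU.
  have W_full := IHN W (leq_trans ltWU leUN) Wsub nzW.
  by rewrite eqEdim subvf /= -W_full ltnW.
pose S i := (linfun (iter i twist) @: U)%VS.
have SP i v : reflect (exists2 u, u \in U & v = iter i twist u) (v \in S i).
  by apply: (iffP memv_imgP) => -[u Uu ->]; exists u; rewrite ?lfunE.
have twist_inj i : injective (iter i twist).
  elim: i => //= i IHi u v /(congr1 (iter p twist)).
  by rewrite -!iterSr !iter_twistm => /IHi.
have nz_w : w != 0 by rewrite (prim_root_eq0 prim_w).
have S_sub i : submod (S i).
  split=> [x|] _ /SP[u Uu ->].
    by apply/SP; exists (act x u); rewrite ?iter_twist_act //; apply: Usub.1.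
  apply/SP; exists ((w ^+ i)^-1 *: shift u); first by rewrite memvZ ?Usub.2.
  by rewrite linearZ /= iter_twist_shift scalerK // expf_neq0.
have dimS i : \dim (S i) = \dim U.
  apply: limg_dim_eq; apply/eqP; rewrite -subv0; apply/subvP=> u.
  rewrite memv_cap memv_ker lfunE memv0 => /andP[_ /eqP u0].
  by apply/eqP/(twist_inj i); rewrite u0 linear0.
have subS (i : 'I_m) : (S i <= \sum_(i < m) S i)%VS by rewrite (sumv_sup i).
have full_sum : (\sum_(i < m) S i = fullv)%VS.
  apply: twist_stable_full.
  - by apply: big_ind => //; [exact: submod0 | exact: submodD].
  - apply: contraNneq nzU => S0; have := subS ord0.
    by rewrite S0 subv0 -dimv_eq0 dimS dimv_eq0.
  move=> _ /memv_sumP[vs Svs ->]; rewrite linear_sum memv_suml // => i _.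
  have /SP[u Uu ->] := Svs i isT; rewrite /= -iterS.
  have := ltn_ord i; rewrite leq_eqVlt => /predU1P[[->] | lt_im].
    by rewrite iter_twistm (subvP (subS ord0)) //; apply/SP; exists u.
  by rewrite (subvP (subS (Ordinal lt_im))) //; apply/SP; exists u.
have dvdU : (\dim U %| m * \dim {:D})%N.
  rewrite -dimM -full_sum; exact: (dvdn_dim_sumv _ submod0 submodD submodI).
have /dvdnP[q dimU] := dvdn_dim_act_stable Usub.1.
have [_ q_prime] := primeP m_prime.
rewrite dimU dvdn_pmul2r ?adim_gt0 // in dvdU.
have /pred2P[q1 | qm] := q_prime q dvdU.
  have ltU2 : (\dim U < 2 * \dim {:D})%N by rewrite dimU q1 ltn_pmul2r ?adim_gt0.
  by have [z /noN] := small_submod_twnorm Usub nzU ltU2.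
by case/eqP: properU; apply/eqP; rewrite eqEdim subvf dimM dimU qm leqnn.
Qed.

End RootOfUnity.

(** For [m = 3] a submodule of dimension at least [2 \dim D] has codimension at
    most [\dim D], so that one of the two dimension counts always applies. *)
Lemma proper_submod_twnorm U : prime m -> d != 0 ->
    (m <> 2%N -> m <> 3%N -> exists w : k, m.-primitive_root w) ->
    submod U -> U != 0%VS -> U != fullv ->
  ~ (forall z, d <> twnorm m z).
Proof.
move=> m_prime nz_d root_m Usub nzU properU noN.
have dim_lt : (\dim U < m * \dim {:D})%N.
  rewrite -dimM ltnNge; apply: contra properU => le_dim.
  by rewrite eqEdim subvf.
have [ltU2 | leU2] := ltnP (\dim U) (2 * \dim {:D}).
  by have [z /noN] := small_submod_twnorm Usub nzU ltU2.
have [m2 | /eqP m_neq2] := eqVneq m 2%N.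
  by rewrite ltnNge [X in (X * _)%N]m2 leU2 in dim_lt.
have [m3 | /eqP m_neq3] := eqVneq m 3%N.
  have ltU : (m * \dim {:D} < \dim U + 2 * \dim {:D})%N.
    rewrite [X in (X * _)%N]m3 (mulnDl 1 2) ltn_add2r.
    by rewrite (leq_trans _ leU2) // ltn_pmul2r ?adim_gt0.
  by have [z /noN] := large_submod_twnorm (prime_gt1 m_prime) Usub properU ltU.
have [w prim_w] := root_m m_neq2 m_neq3.
by case/eqP: properU; apply: (prime_root_submod_full prim_w).
Qed.

Theorem pmul_domain_iff : prime m -> d != 0 ->
    (m <> 2%N -> m <> 3%N -> exists w : k, m.-primitive_root w) ->
  (forall g h, pmul g h = 0 -> g = 0 \/ h = 0) <-> (forall z, d <> twnorm m z).
Proof.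
move=> m_prime nz_d root_m; split=> [domM z def_d | noN g h gh0].
  have [g [h [nz_g nz_h /domM]]] := twnorm_zero_divisor (prime_gt1 m_prime) def_d.
  by case=> /eqP; apply/negP.
apply/pred2P; apply: contraT; rewrite negb_or => /andP[nz_g nz_h].
have [U [Usub nzU properU]] := zero_divisor_submod nz_g nz_h gh0.
by case: (proper_submod_twnorm m_prime nz_d root_m Usub nzU properU).
Qed.

End PetitModule.

(** * Associative cyclic algebras *)

Section AssociativeAlgebra.

Variables (k : fieldType) (A : naAlg k).

(** A copy of the carrier of [A], keyed by the proofs that make it a ring. *)
Definition assoc_alg (mulA : associative (@na_mul k A))
  (nz1 : na_one A != 0) : Type := A.

Variables (mulA : associative (@na_mul k A)) (nz1 : na_one A != 0).
Local Notation T := (assoc_alg mulA nz1).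

HB.instance Definition _ := Vector.copy T A.

Fact na_mulDl : left_distributive (@na_mul k A) +%R.
Proof. by move=> x y z; have:= na_mul_linl z 1 x y; rewrite !scale1r. Qed.
Fact na_mulDr : right_distributive (@na_mul k A) +%R.
Proof. by move=> x y z; have:= na_mul_linr x 1 y z; rewrite !scale1r. Qed.
HB.instance Definition _ := GRing.Zmodule_isNzRing.Build T
  mulA (@na_mul1x k A) (@na_mulx1 k A) na_mulDl na_mulDr nz1.

Fact na_scaleAl a (x y : T) : a *: (x * y) = (a *: x) * y.
Proof. by symmetry; apply: (GRing.scalable_linear (@na_mul_linl k A y)). Qed.
HB.instance Definition _ := GRing.Lmodule_isLalgebra.Build k T na_scaleAl.
Fact na_scaleAr a (x y : T) : a *: (x * y) = x * (a *: y).
Proof. by symmetry; apply: (GRing.scalable_linear (@na_mul_linr k A x)). Qed.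
HB.instance Definition _ := GRing.Lalgebra_isAlgebra.Build k T na_scaleAr.
HB.instance Definition _ := Algebra_isFalgebra.Build k T.

End AssociativeAlgebra.

Section CyclicMonomials.

Variables (k : fieldType) (E : fieldExtType k) (r : nat).
Implicit Type i : 'I_r.

Lemma cyc_monB i (u v : E) : cyc_mon i (u - v) = cyc_mon i u - cyc_mon i v.
Proof. by apply/ffunP=> l; rewrite !ffunE; case: ifP; rewrite ?subr0. Qed.

Lemma cyc_monZ i (b : k) (u : E) : cyc_mon i (b *: u) = b *: cyc_mon i u.
Proof. by apply/ffunP=> l; rewrite !ffunE; case: ifP; rewrite ?scaler0. Qed.

Lemma sum_cyc_mon (x : {ffun 'I_r -> E}) : x = \sum_(i < r) cyc_mon i (x i).
Proof.
apply/ffunP=> l; rewrite sum_ffunE (bigD1 l) //= big1 => [|i /negPf ne_i].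
  by rewrite ffunE eqxx addr0.
by rewrite ffunE eq_sym ne_i.
Qed.

End CyclicMonomials.

Section CyclicAssociative.

Variables (k : fieldType) (E : fieldExtType k) (r : nat).
Variables (rho : 'AEnd(E)) (a : E).
Hypotheses (rho_r : iter r.+1 rho =1 id) (rho_a : rho a = a).

Local Notation mul := (@cyc_mul k E r.+1 rho a).
Local Notation mon := (@cyc_mon k E r.+1).

(** The reduction of [e^i u] by [e^r = a] for an arbitrary exponent; without a
    bound on [i] the product rule [red_monM] has no case distinction, and
    associativity is immediate on monomials. *)
Definition red_mon (i : nat) (u : E) :=
  mon (inord (i %% r.+1)) (a ^+ (i %/ r.+1) * u).

Lemma iter_rho_modn j u : iter (j %% r.+1) rho u = iter j rho u.
Proof.
rewrite [in RHS](divn_eq j r.+1) iterD; elim: (j %/ r.+1)%N => // q IHq.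
by rewrite mulSn iterD rho_r.
Qed.

Lemma iter_rho_a j : iter j rho a = a.
Proof. by elim: j => //= j ->. Qed.

Lemma red_monM i j u v :
  mul (red_mon i u) (red_mon j v) = red_mon (i + j) (iter j rho u * v).
Proof.
have [lti ltj] : (i %% r.+1 < r.+1)%N /\ (j %% r.+1 < r.+1)%N by rewrite !ltn_mod.
rewrite /red_mon.
set i0 := (i %% r.+1)%N in lti *; set j0 := (j %% r.+1)%N in ltj *.
have itrho: iter j0 rho (a ^+ (i %/ r.+1) * u) = a ^+ (i %/ r.+1) * iter j rho u.
  by rewrite iter_rho_modn rmorphM rmorphXn /= iter_rho_a.
have [lt_ij | le_ij] := ltnP (i0 + j0) r.+1.
  have eq_m : ((i + j) %% r.+1 = i0 + j0)%N by rewrite -modnDm modn_small.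
  have eq_d : ((i + j) %/ r.+1 = i %/ r.+1 + j %/ r.+1)%N.
    by rewrite divnD // leqNgt lt_ij addn0.
  rewrite (@cyc_mul_mon_lt _ _ _ _ _ _ _ (inord ((i + j) %% r.+1))); last first.
    by rewrite !inordK ?ltn_mod // eq_m.
  by rewrite inordK // itrho eq_d exprD; congr (mon _ _); ring.
have lt_r : (i0 + j0 - r.+1 < r.+1)%N.
  rewrite ltn_subLR // (leq_trans (_ : _ < r.+1 + j0)%N) ?ltn_add2r //.
  by rewrite leq_add2l ltnW.
have eq_m : ((i + j) %% r.+1 = i0 + j0 - r.+1)%N.
  by rewrite -modnDm -/i0 -/j0 -{1}(subnK le_ij) modnDr modn_small.
have eq_d : ((i + j) %/ r.+1 = (i %/ r.+1 + j %/ r.+1).+1)%N.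
  by rewrite divnD // le_ij addn1.
rewrite (@cyc_mul_mon_ge _ _ _ _ _ _ _ (inord ((i + j) %% r.+1))); last first.
  by rewrite !inordK ?ltn_mod // eq_m subnK.
by rewrite inordK // itrho eq_d exprS exprD; congr (mon _ _); ring.
Qed.

Lemma sum_red_mon (x : {ffun 'I_r.+1 -> E}) :
  x = \sum_(i < r.+1) red_mon i (x i).
Proof.
rewrite [LHS]sum_cyc_mon; apply: eq_bigr => i _.
by rewrite /red_mon modn_small // divn_small // inord_val mul1r.
Qed.

Lemma cyc_mulA : associative mul.
Proof.
have mulr_sum x :=
  zmod_morphism_sum (GRing.zmod_morphism_linear (cyc_mul_linr rho a x)).
have mull_sum x :=
  zmod_morphism_sum (GRing.zmod_morphism_linear (cyc_mul_linl rho a x)).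
move=> x y z; rewrite (sum_red_mon x) !mull_sum; apply: eq_bigr => i _.
rewrite (sum_red_mon y) !(mull_sum, mulr_sum); apply: eq_bigr => j _.
rewrite (sum_red_mon z) !mulr_sum; apply: eq_bigr => l _.
by rewrite !red_monM addnA rmorphM /= -iterD mulrA (addnC l).
Qed.

End CyclicAssociative.

(** * Restriction of scalars and the composite field *)

Lemma eq_on_pure (k : fieldType) (U V : vectType k) (W : zmodType)
    (g h : tens U V -> W) :
    zmod_morphism g -> zmod_morphism h ->
  (forall u v, g (tens_pure u v) = h (tens_pure u v)) -> g =1 h.
Proof.
move=> gB hB eq_gh.
pose g' : {additive tens U V -> W} :=
  HB.pack g (GRing.isZmodMorphism.Build _ _ g gB).
pose h' : {additive tens U V -> W} :=
  HB.pack h (GRing.isZmodMorphism.Build _ _ h hB).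
exact: (tens_ext (g := g') (h := h')).
Qed.

Section BaseRestriction.

Variables (F0 : fieldType) (F : fieldExtType F0) (K : fieldExtType F).

Section Morphism.
Variable rho : 'AEnd(K).

Let rho0 (x : baseFieldType K) : baseFieldType K := rho x.

Fact base_restrict_linear : linear rho0.
Proof. by move=> b x y; rewrite /rho0 linearP. Qed.
Fact base_restrict_monoid : monoid_morphism rho0.
Proof. by split=> [|x y]; rewrite /rho0 (rmorph1, rmorphM). Qed.

Definition base_restrict : 'AEnd(baseFieldType K) :=
  linfun_ahom (HB.pack_for {lrmorphism baseFieldType K -> baseFieldType K} rho0
    (GRing.isLinear.Build F0 _ _ _ rho0 base_restrict_linear)
    (GRing.isMonoidMorphism.Build _ _ rho0 base_restrict_monoid)).

Lemma base_restrictE x : base_restrict x = rho x. Proof. by rewrite lfunE. Qed.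

End Morphism.

Lemma cyc_mul_base (r : nat) (rho : 'AEnd(K)) (a : K) (x y : {ffun 'I_r -> K}) :
  @cyc_mul F0 (baseFieldType K) r (base_restrict rho) a x y = cyc_mul rho a x y.
Proof.
apply/ffunP=> l; rewrite !ffunE; apply: eq_bigr => i _; apply: eq_bigr => j _.
by rewrite (eq_iter (base_restrictE rho)).
Qed.

End BaseRestriction.

Section Composite.

Variables (F0 : fieldType) (L F : fieldExtType F0) (K : fieldExtType F).
Variable iL : {rmorphism L -> K}.
Hypothesis iL_F0 : forall b : F0, iL b%:A = (b%:A : F)%:A.

Lemma iL_scale (b : F0) x : iL (b *: x) = (b%:A : F) *: iL x.
Proof. by rewrite -[b *: x]mulr_algl rmorphM iL_F0 mulr_algl. Qed.

Fact composite_map_zmod : zmod_morphism (composite_map iL).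
Proof. by apply: tens_lift_add => y u v; rewrite rmorphB scalerBr. Qed.

HB.instance Definition _ :=
  GRing.isZmodMorphism.Build (tens L F) K (composite_map iL) composite_map_zmod.

Lemma composite_map_pure x y : composite_map iL (tens_pure x y) = y *: iL x.
Proof.
apply: tens_lift_pure => [u v w|v u w|b u v].
- by rewrite scalerBl.
- by rewrite rmorphB scalerBr.
by rewrite iL_scale scalerA mulr_algr.
Qed.

Hypothesis compK : is_composite iL.

(** The products [y *: iL x] generate [K] additively. *)
Lemma eq_on_composite (W : zmodType) (g h : K -> W) :
    zmod_morphism g -> zmod_morphism h ->
  (forall x y, g (y *: iL x) = h (y *: iL x)) -> g =1 h.
Proof.
move=> gB hB eq_gh z; have [t <-] := compK z.
apply: (@eq_on_pure _ L F W (g \o composite_map iL) (h \o composite_map iL))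
  => [u v|u v|x y] /=.
- by rewrite raddfB gB.
- by rewrite raddfB hB.
by rewrite composite_map_pure eq_gh.
Qed.

Fact composite_ex z : exists t, composite_map iL t == z.
Proof. by have [t <-] := compK z; exists t. Qed.

Definition composite_inv z : tens L F := xchoose (composite_ex z).

Lemma composite_invK : cancel composite_inv (composite_map iL).
Proof. by move=> z; apply/eqP/(xchooseP (composite_ex z)). Qed.

Hypothesis disjLF : linearly_disjoint iL.

Lemma composite_mapK : cancel (composite_map iL) composite_inv.
Proof. by move=> t; apply: disjLF; rewrite composite_invK. Qed.

Fact composite_inv_zmod : zmod_morphism composite_inv.
Proof. by move=> z t; apply: disjLF; rewrite raddfB /= !composite_invK. Qed.

End Composite.


(** * The tensor product as an algebra of twisted remainders *)

Section TensorDecomposition.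

Variables (F0 : fieldType) (L F : fieldExtType F0) (K : fieldExtType F).
Variables (iL : {rmorphism L -> K}) (r p : nat).
Variables (sigma : 'AEnd(L)) (tau : 'AEnd(F)) (sigmaK : 'AEnd(K)).
Variables (tauK : {rmorphism K -> K}) (c : F0) (d : F).
Hypothesis iL_F0 : forall b : F0, iL b%:A = (b%:A : F)%:A.
Hypotheses (disjLF : linearly_disjoint iL) (compK : is_composite iL).
Hypotheses (sigma_n : iter r.+1 sigma =1 id) (tau_m : iter p.+1 tau =1 id).
Hypothesis sigmaK_L : forall x : L, sigmaK (iL x) = iL (sigma x).
Hypothesis tauK_L : forall x : L, tauK (iL x) = iL x.
Hypothesis tauK_F : forall y : F, tauK y%:A = (tau y)%:A.

Local Notation n := r.+1.
Local Notation m := p.+1.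
Local Notation K0 := (baseFieldType K).

Lemma iter_sigmaK j y x : iter j sigmaK (y *: iL x) = y *: iL (iter j sigma x).
Proof. by elim: j => //= j ->; rewrite linearZ /= sigmaK_L. Qed.

Lemma tauK_scale y z : tauK (y *: z) = tau y *: tauK z.
Proof. by rewrite -[y *: z]mulr_algl rmorphM tauK_F mulr_algl. Qed.

Lemma iter_tauK j y x : iter j tauK (y *: iL x) = iter j tau y *: iL x.
Proof. by elim: j => //= j ->; rewrite tauK_scale tauK_L. Qed.

Lemma sigmaK_n : iter n sigmaK =1 id.
Proof.
apply: (eq_on_composite iL_F0 compK) => [u v|//|x y]; first exact: raddfB.
by rewrite iter_sigmaK sigma_n.
Qed.

Lemma tauK_m : iter m tauK =1 id.
Proof.
apply: (eq_on_composite iL_F0 compK) => [u v|//|x y]; first exact: raddfB.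
by rewrite iter_tauK tau_m.
Qed.

Lemma tauK_sigmaK z : tauK (sigmaK z) = sigmaK (tauK z).
Proof.
move: z; apply: (eq_on_composite iL_F0 compK) => [u v|u v|x y].
- by rewrite !raddfB.
- by rewrite !raddfB.
by rewrite tauK_scale !linearZ /= tauK_L tauK_scale sigmaK_L tauK_L.
Qed.

Definition cK : K0 := iL c%:A.

Lemma sigmaK_cK : base_restrict sigmaK cK = cK.
Proof. by rewrite base_restrictE sigmaK_L linearZ /= rmorph1. Qed.

(** The algebra [D] over [F0] instead of [F]: its automorphism [theta] below is
    linear only over [F0]. *)
Definition base_alg : naAlg F0 := cyclic_alg n (base_restrict sigmaK) cK.

Lemma base_alg_mulA : associative (@na_mul F0 base_alg).
Proof.
apply: cyc_mulA sigmaK_cK => z.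
by rewrite (eq_iter (base_restrictE sigmaK)) sigmaK_n.
Qed.

Lemma base_alg_one_neq0 : na_one base_alg != 0.
Proof. by apply/eqP=> /ffunP/(_ ord0)/eqP; rewrite !ffunE oner_eq0. Qed.

Local Notation Delta := (assoc_alg base_alg_mulA base_alg_one_neq0).

Lemma DeltaM (x y : Delta) :
  x * y = cyc_mul sigmaK (iL c%:A) (x : {ffun 'I_n -> K}) (y : {ffun 'I_n -> K}).
Proof. exact: cyc_mul_base. Qed.

Definition theta (x : Delta) : Delta :=
  [ffun i => tauK ((x : {ffun 'I_n -> K}) i)].

Fact theta_is_linear : linear theta.
Proof.
move=> b x y; apply/ffunP=> i; rewrite !ffunE rmorphD /= baseField_scaleE tauK_scale.
by rewrite linearZ /= rmorph1 baseField_scaleE.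
Qed.

Fact theta_is_monoid : monoid_morphism theta.
Proof.
have itC j z : tauK (iter j sigmaK z) = iter j sigmaK (tauK z).
  by elim: j => //= j <-; rewrite tauK_sigmaK.
split=> [|x y]; first by apply/ffunP=> i; rewrite !ffunE rmorph_nat.
rewrite !DeltaM; apply/ffunP=> l; rewrite !ffunE rmorph_sum /=.
apply: eq_bigr => i _; rewrite rmorph_sum /=; apply: eq_bigr => j _; rewrite !ffunE.
by do 2?[case: ifP => _]; rewrite ?rmorph0 // !rmorphM /= ?itC ?tauK_L.
Qed.

HB.instance Definition _ :=
  GRing.isLinear.Build F0 Delta Delta *:%R theta theta_is_linear.
HB.instance Definition _ :=
  GRing.isMonoidMorphism.Build Delta Delta theta theta_is_monoid.

Lemma iter_thetaE j (x : Delta) :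
  iter j theta x = [ffun i => iter j tauK ((x : {ffun 'I_n -> K}) i)]
    :> {ffun 'I_n -> K}.
Proof.
elim: j => [|j IHj]; apply/ffunP=> i; first by rewrite !ffunE.
by rewrite iterS /theta ffunE IHj !ffunE.
Qed.

Lemma theta_m : iter m theta =1 id.
Proof. by move=> x; rewrite iter_thetaE; apply/ffunP=> i; rewrite ffunE tauK_m. Qed.

(** The element [x (x) y] of [D = D0 (x) F]. *)
Definition emb (x : {ffun 'I_n -> L}) (y : F) : Delta := [ffun i => y *: iL (x i)].

Lemma embM x x' y y' :
  emb x y * emb x' y' = emb (cyc_mul sigma c%:A x x') (y * y').
Proof.
rewrite DeltaM; apply/ffunP=> l; rewrite !ffunE rmorph_sum scaler_sumr.
apply: eq_bigr => i _; rewrite rmorph_sum scaler_sumr; apply: eq_bigr => j _.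
rewrite !ffunE iter_sigmaK; case: ifP => _.
  by rewrite rmorphM -scalerAl -scalerAr scalerA.
case: ifP => _; last by rewrite rmorph0 scaler0.
by rewrite !rmorphM -scalerAr -[in LHS]scalerAr -[in LHS]scalerAl scalerA mulrC.
Qed.

Lemma iter_theta_emb j x y : iter j theta (emb x y) = emb x (iter j tau y).
Proof.
rewrite iter_thetaE; apply/ffunP=> i; rewrite !ffunE.
exact: iter_tauK.
Qed.

Definition dD : Delta := [ffun i : 'I_n => d *: (i == 0 :> nat)%:R : K].

Lemma dDE : dD = d *: na_one (cyclic_alg n sigmaK (iL c%:A)) :> {ffun 'I_n -> K}.
Proof. by apply/ffunP=> i; rewrite !ffunE. Qed.

Lemma dD_mull x : dD * x = d *: (x : {ffun 'I_n -> K}) :> {ffun 'I_n -> K}.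
Proof.
rewrite DeltaM dDE.
have := GRing.scalable_linear (@cyc_mul_linl F K n sigmaK (iL c%:A) x) => ->.
by rewrite cyc_mul1x.
Qed.

Lemma dD_mulr x : x * dD = d *: (x : {ffun 'I_n -> K}) :> {ffun 'I_n -> K}.
Proof.
rewrite DeltaM dDE.
have := GRing.scalable_linear (@cyc_mul_linr F K n sigmaK (iL c%:A) x) => ->.
by rewrite cyc_mulx1.
Qed.

Lemma dD_central x : dD * x = x * dD. Proof. by rewrite dD_mull -dD_mulr. Qed.

Lemma dD_emb x y : dD * emb x y = emb x (d * y).
Proof. by rewrite dD_mull; apply/ffunP=> i; rewrite !ffunE scalerA. Qed.

Lemma dD_neq0 : d != 0 -> dD != 0.
Proof.
move=> nz_d; apply/eqP=> /ffunP/(_ ord0)/eqP; rewrite !ffunE /=.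
by rewrite [_ == _](scaler_eq0 d (1 : K)) oner_eq0 orbF (negPf nz_d).
Qed.

Lemma Delta_division : division_alg (cyclic_alg n sigmaK (iL c%:A)) ->
  forall x : Delta, x != 0 -> x \is a GRing.unit.
Proof.
case=> _ divD x nz_x; have [[f _ mulf] [g _ mulg]] := divD x nz_x.
pose f1 : Delta := f (na_one _); pose g1 : Delta := g (na_one _).
have mulf1: x * f1 = 1 by rewrite DeltaM; apply: mulf.
have mulg1: g1 * x = 1 by rewrite DeltaM; apply: mulg.
have eq_gf: g1 = f1 by rewrite -[LHS]mulr1 -mulf1 mulrA mulg1 mul1r.
by apply/unitrP; exists f1; rewrite -{1}eq_gf.
Qed.

Lemma theta_twnorm_cyc (z : Delta) :
  twnorm theta m z =
    twisted_norm (A := cyclic_alg n sigmaK (iL c%:A)) (cyc_map tauK) m z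
    :> {ffun 'I_n -> K}.
Proof.
rewrite /twnorm /twisted_norm; apply: (big_ind2 (fun (x : Delta) y => x = y)) => //.
by move=> x _ y _ <- <-; apply: DeltaM.
Qed.

Local Notation A := (cyclic_alg n sigma c%:A).
Local Notation B := (cyclic_alg m tau d).
Local Notation M := {ffun 'I_m -> Delta}.
Local Notation pmulD := (pmul theta dD).

Lemma embDr x y y' : emb x (y - y') = emb x y - emb x y'.
Proof. by apply/ffunP=> i; rewrite !ffunE scalerBl. Qed.

Lemma embDl y x x' : emb (x - x') y = emb x y - emb x' y.
Proof. by apply/ffunP=> i; rewrite !ffunE rmorphB scalerBr. Qed.

(** The element [x (x) \sum_j e^j b_j] of the tensor product becomes
    [\sum_j t^j (x (x) b_j)]. *)
Definition emb_ffun (x : A) (b : B) : M :=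
  [ffun j => emb x ((b : {ffun 'I_m -> F}) j)].

Definition tens_to_pmul : tens A B -> M := tens_lift emb_ffun.

Fact tens_to_pmul_zmod : zmod_morphism tens_to_pmul.
Proof.
apply: tens_lift_add => b x y; apply/ffunP=> j.
by rewrite !ffunE embDl.
Qed.

HB.instance Definition _ :=
  GRing.isZmodMorphism.Build (tens A B) M tens_to_pmul tens_to_pmul_zmod.

Lemma tens_to_pmul_pure x b : tens_to_pmul (tens_pure x b) = emb_ffun x b.
Proof.
apply: tens_lift_pure => [u v w|v u w|e u v]; apply/ffunP=> j; rewrite !ffunE.
- by rewrite embDr.
- by rewrite embDl.
by apply/ffunP=> i; rewrite !ffunE iL_scale // scalerA mulr_algr.
Qed.

(** Both products reduce [t^(i+j)] in the same way, and [theta] acts on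
    [x (x) y] through [tau] alone, as it does on the [b_j]. *)
Lemma emb_ffunM x b x' b' :
  emb_ffun (na_mul x x') (na_mul b b') = pmulD (emb_ffun x b) (emb_ffun x' b').
Proof.
apply/ffunP=> l.
have sumE I (s : seq I) G y :
    emb y (\sum_(i <- s) G i) = \sum_(i <- s) emb y (G i).
  apply: (big_morph (emb y) (id1 := 0) (op1 := +%R)) => [u v|].
    by apply/ffunP=> i; rewrite !ffunE scalerDl.
  by apply/ffunP=> i; rewrite !ffunE scale0r.
rewrite pmulE !ffunE sumE; apply: eq_bigr => i _.
rewrite sumE; apply: eq_bigr => j _.
rewrite !ffunE !iter_theta_emb.
case: ifP => _; first by rewrite embM.
case: ifP => _; first by rewrite dD_emb embM.
by apply/ffunP=> t; rewrite !ffunE scale0r.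
Qed.

Lemma tens_to_pmulM s t :
  tens_to_pmul (tens_mul s t) = pmulD (tens_to_pmul s) (tens_to_pmul t).
Proof.
have PB := tens_to_pmul_zmod.
move: s; apply: eq_on_pure => [u v|u v|x b].
- by rewrite (GRing.zmod_morphism_linear (tens_mul_linl t)) PB.
- by rewrite PB pmul_zmod_morphisml.
move: t; apply: eq_on_pure => [u v|u v|x' b'].
- by rewrite (GRing.zmod_morphism_linear (tens_mul_linr _)) PB.
- by rewrite PB pmul_zmod_morphismr.
by rewrite tens_mul_pure !tens_to_pmul_pure emb_ffunM.
Qed.

(** Multiplies [x (x) y] by the monomial [e^i (x) e^j]. *)
Definition tens_mon (i : 'I_n) (j : 'I_m) : tens L F -> tens A B :=
  tens_lift (fun x y => tens_pure (cyc_mon i x : A) (cyc_mon j y : B)).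

Fact tens_mon_zmod i j : zmod_morphism (tens_mon i j).
Proof.
apply: tens_lift_add => y u v; rewrite cyc_monB.
exact: (GRing.zmod_morphism_linear (tens_pure_linl _)).
Qed.

Lemma tens_mon_pure i j x y :
  tens_mon i j (tens_pure x y) = tens_pure (cyc_mon i x : A) (cyc_mon j y : B).
Proof.
apply: tens_lift_pure => [u v w|v u w|b u v].
- rewrite cyc_monB; exact: (GRing.zmod_morphism_linear (tens_pure_linr _)).
- rewrite cyc_monB; exact: (GRing.zmod_morphism_linear (tens_pure_linl _)).
rewrite !cyc_monZ (GRing.scalable_linear (tens_pure_linl _)).
by rewrite (GRing.scalable_linear (tens_pure_linr _)).
Qed.

(** Each coefficient in [K] is pulled back to [L (x) F] by linear disjointness and
    put at its place among the monomials. *)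
Definition pmul_to_tens (v : M) : tens A B :=
  \sum_(i < n) \sum_(j < m)
    tens_mon i j (composite_inv compK ((v j : {ffun 'I_n -> K}) i)).

Lemma tens_to_pmul_mon i j t :
  tens_to_pmul (tens_mon i j t) =
    [ffun j' => [ffun i' =>
      if (i' == i) && (j' == j) then composite_map iL t else 0]].
Proof.
move: t; apply: eq_on_pure => [u v|u v|x y].
- by rewrite tens_mon_zmod tens_to_pmul_zmod.
- apply/ffunP=> j'; rewrite !ffunE; apply/ffunP=> i'; rewrite !ffunE.
  by case: ifP; rewrite ?raddfB ?subr0.
rewrite tens_mon_pure tens_to_pmul_pure composite_map_pure //.
apply/ffunP=> j'; rewrite !ffunE; apply/ffunP=> i'; rewrite !ffunE.
by case: eqP => _; case: eqP => _ //=; rewrite ?rmorph0 ?scaler0 ?scale0r.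
Qed.

Lemma pmul_to_tensK : cancel pmul_to_tens tens_to_pmul.
Proof.
move=> v; rewrite /pmul_to_tens raddf_sum /=; apply/ffunP=> j0; rewrite sum_ffunE.
apply/ffunP=> i0; rewrite sum_ffunE (bigD1 i0) //= [X in _ + X]big1 ?addr0
  => [|i /negPf ne_i].
  rewrite raddf_sum !sum_ffunE (bigD1 j0) //= big1 ?addr0 => [|j /negPf ne_j].
    by rewrite tens_to_pmul_mon !ffunE !eqxx composite_invK.
  by rewrite tens_to_pmul_mon !ffunE eq_sym ne_j andbF.
rewrite raddf_sum !sum_ffunE big1 // => j _.
by rewrite /= tens_to_pmul_mon !ffunE eq_sym ne_i.
Qed.

Fact pmul_to_tens_zmod : zmod_morphism pmul_to_tens.
Proof.
move=> u v; rewrite /pmul_to_tens -sumrB; apply: eq_bigr => i _.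
rewrite -sumrB; apply: eq_bigr => j _.
by rewrite !ffunE composite_inv_zmod // tens_mon_zmod.
Qed.

Lemma tens_to_pmulK : cancel tens_to_pmul pmul_to_tens.
Proof.
apply: eq_on_pure => [u v|//|x b].
  by rewrite tens_to_pmul_zmod pmul_to_tens_zmod.
transitivity (\sum_(i < n) \sum_(j < m)
    tens_pure (cyc_mon i (x i) : A) (cyc_mon j (b j) : B)).
  apply: eq_bigr => i _; apply: eq_bigr => j _.
  rewrite tens_to_pmul_pure !ffunE -composite_map_pure //.
  by rewrite composite_mapK // tens_mon_pure.
rewrite [in RHS](sum_cyc_mon x) [in RHS](sum_cyc_mon b).
rewrite (zmod_morphism_sum (GRing.zmod_morphism_linear (tens_pure_linl _))).
apply: eq_bigr => i _.
by rewrite (zmod_morphism_sum (GRing.zmod_morphism_linear (tens_pure_linr _))).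
Qed.

(** Transport of [pmul_domain_iff] along the additive bijection [tens_to_pmul]. *)
Theorem tens_division_iff : prime m -> d != 0 ->
    (m <> 2%N -> m <> 3%N -> exists w : F0, m.-primitive_root w) ->
    division_alg (cyclic_alg n sigmaK (iL c%:A)) ->
  division_alg (tens_alg A B) <->
  (forall z : cyclic_alg n sigmaK (iL c%:A),
     d *: na_one (cyclic_alg n sigmaK (iL c%:A))
       <> twisted_norm (cyc_map tauK) m z).
Proof.
move=> m_prime nz_d root_m divD.
have toM0 : tens_to_pmul 0 = 0 by rewrite -(subrr 0) tens_to_pmul_zmod subrr.
have toM_eq0 s : tens_to_pmul s = 0 -> s = 0.
  by rewrite -toM0 => /(can_inj tens_to_pmulK).
have domE := pmul_domain_iff (Delta_division divD) theta_m dD_central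
               m_prime (dD_neq0 nz_d) root_m.
apply: (iff_trans (B := forall g h : M, pmulD g h = 0 -> g = 0 \/ h = 0));
  last first.
  apply: (iff_trans domE).
  by split=> noN z; have:= noN z; rewrite -dDE theta_twnorm_cyc.
split=> [[_ divA] g h gh0 | domM].
  have [-> | nz_g] := eqVneq g 0; [by left | right].
  have nz_s : pmul_to_tens g != 0.
    by apply: contraNneq nz_g => s0; rewrite -(pmul_to_tensK g) s0 toM0.
  have [/bij_inj inj_s _] := divA _ nz_s.
  have mulB := GRing.zmod_morphism_linear (tens_mul_linr (pmul_to_tens g)).
  have mul0 : tens_mul (pmul_to_tens g) 0 = 0.
    by have:= mulB 0 0; rewrite !subrr.
  rewrite -(pmul_to_tensK h) -toM0; congr tens_to_pmul; apply: inj_s => /=.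
  rewrite mul0; apply: toM_eq0.
  by rewrite tens_to_pmulM !pmul_to_tensK.
apply: division_alg_domain => [|s t st0].
  exists (pmul_to_tens [ffun=> 1]); apply/eqP=> u0.
  have:= pmul_to_tensK [ffun=> 1]; rewrite u0 toM0 => /ffunP/(_ ord0)/esym/eqP.
  by rewrite !ffunE oner_eq0.
have := domM (tens_to_pmul s) (tens_to_pmul t).
rewrite -tens_to_pmulM [tens_mul s t]st0 toM0.
by case=> // /toM_eq0; [left | right].
Qed.

End TensorDecomposition.

Lemma iter_gal_generator (F0 : fieldType) (L : splittingFieldType F0)
    (s : gal_of {:L}) :
    galois 1%VS {:L} -> 'Gal({:L} / 1%VS)%g = <[s]>%g ->
  iter (\dim {:L}) s =1 id.
Proof.
move=> galL genL x.
have ->: \dim {:L} = #[s]%g by rewrite orderE -genL -galois_dim // dimv1 divn1.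
suffices itE j : iter j s x = (s ^+ j)%g x by rewrite itE expg_order gal_id.
elim: j => [|j IHj]; first by rewrite gal_id.
by rewrite iterS IHj expgSr galM ?memvf.
Qed.

Theorem theorem14 (F0 : fieldType) (L F : splittingFieldType F0) (n m : nat)
    (sigma : gal_of {:L}) (tau : gal_of {:F})
    (galL : galois 1%VS {:L}) (dimL : \dim {:L} = n)
    (gensigma : 'Gal({:L} / 1%VS)%g = <[sigma]>%g)
    (galF : galois 1%VS {:F}) (dimF : \dim {:F} = m)
    (gentau : 'Gal({:F} / 1%VS)%g = <[tau]>%g)
    (K : fieldExtType F) (iL : {rmorphism L -> K})
    (iL_F0 : forall b : F0, iL b%:A = (b%:A : F)%:A)
    (disjLF : linearly_disjoint iL) (compK : is_composite iL)
    (sigmaK : 'AEnd(K)) (sigmaK_L : forall x : L, sigmaK (iL x) = iL (sigma x))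
    (tauK : {rmorphism K -> K})
    (tauK_L : forall x : L, tauK (iL x) = iL x)
    (tauK_F : forall y : F, tauK y%:A = (tau y)%:A)
    (d : F) (d_notin_F0 : d \notin 1%VS)
    (c : F0) (c_neq0 : c != 0)
    (D := cyclic_alg n sigmaK (iL c%:A))
    (divD : division_alg D)
    (m_prime : prime m)
    (root_m : m <> 2%N -> m <> 3%N -> exists w : F0, m.-primitive_root w) :
  division_alg (tens_alg (cyclic_alg n sigma c%:A) (cyclic_alg m tau d)) <->
  (forall z : D, d *: na_one D <> twisted_norm (cyc_map tauK) m z).
Proof.
have sigma_n := iter_gal_generator galL gensigma; rewrite dimL in sigma_n.
have tau_m := iter_gal_generator galF gentau; rewrite dimF in tau_m.
have nz_d : d != 0 by apply: contraNneq d_notin_F0 => ->; apply: mem0v.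
have n_gt0 : (0 < n)%N by rewrite -dimL adim_gt0.
case: n m @D n_gt0 dimL dimF sigma_n tau_m divD m_prime root_m
  => [//|r] [//|p] D _ _ _.
move=> sigma_n tau_m divD m_prime root_m.
exact: (tens_division_iff (sigma := sigma) (tau := tau)).
Qed.
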